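(* (1) For any $\lambda\in[0,1)$: $\omega\text{-}\mathrm{RL}\not\subseteq\mathbb{L}^{>\lambda}(\mathrm{QBA}|\mathrm{D})$. (2) For any $\lambda\in[0,1)$: $\omega\text{-}\mathrm{CFL}\setminus\omega\text{-}\mathrm{RL}\not\subseteq\mathbb{L}^{>\lambda}(\mathrm{QBA}|\mathrm{D})$. (3) $\mathbb{L}^{=1}(\mathrm{QBA}|\mathrm{D})\not\subseteq\omega\text{-}\mathrm{RL}$.
   Context: A quantum automaton is a tuple $\mathcal{A}=(\mathcal{H},|s_0\rangle,\Sigma,\{U_\sigma:\sigma\in\Sigma\},F)$ where $\mathcal{H}$ is a finite-dimensional complex Hilbert space, $|s_0\rangle$ a unit vector, $\Sigma$ a finite alphabet, each $U_\sigma$ unitary, and $F$ a subspace. For $w=\sigma_1\sigma_2\cdots\in\Sigma^\omega$, a unit vector $|\psi\rangle\in F$ and checkpoints $0\le n_1<n_2<\cdots$, the disturbing run is $|s_0\rangle$ and for $n\ge1$: $|s_n\rangle=U_{\sigma_n}|\psi\rangle$ if $n-1=n_i$ for some $i$, else $|s_n\rangle=U_{\sigma_n}|s_{n-1}\rangle$; $f^{\mathrm{D}}_{\mathcal{A}}(w)=\sup_{|\psi\rangle}\sup_{\{n_i\}}\inf_{i\ge1}|\langle\psi|s_{n_i}\rangle|^2$. $\mathcal{L}^{>\lambda}(\mathcal{A}|\mathrm{D})=\{w:f^{\mathrm{D}}_{\mathcal{A}}(w)>\lambda\}$, $\mathcal{L}^{=1}(\mathcal{A}|\mathrm{D})=\{w:f^{\mathrm{D}}_{\mathcal{A}}(w)=1\}$;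 $\mathbb{L}^{>\lambda}(\mathrm{QBA}|\mathrm{D})$, $\mathbb{L}^{=1}(\mathrm{QBA}|\mathrm{D})$ are the classes of all such languages over all quantum automata. $\omega\text{-}\mathrm{RL}$ (resp. $\omega\text{-}\mathrm{CFL}$) is the class of all $\omega$-languages $\bigcup_{i=1}^n U_iV_i^\omega$ with $U_i,V_i$ regular (resp. context-free) languages of finite words, $V^\omega$ being the set of infinite concatenations of nonempty words from $V$. *)

(* Defs.v *)
From mathcomp Require Import all_boot all_algebra.
From mathcomp Require Import all_classical all_reals.
From mathcomp Require Import complex sesquilinear spectral.
From Stdlib Require Import Relation_Operators.
Set Implicit Arguments.
Unset Strict Implicit.
Unset Printing Implicit Defensive.
Import GRing.Theory Num.Theory.
Local Open Scope ring_scope.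
Local Open Scope classical_set_scope.

Definition lang (S : finType) := set (seq S).
Definition olang (S : finType) := set (nat -> S).

Record dfa (S : finType) := DFA {
  dfa_state : finType;
  dfa_init : dfa_state;
  dfa_trans : dfa_state -> S -> dfa_state;
  dfa_final : {set dfa_state} }.

Definition dfa_accepts (S : finType) (A : dfa S) (u : seq S) : Prop :=
  foldl (@dfa_trans S A) (dfa_init A) u \in dfa_final A.

Definition regular (S : finType) (L : lang S) : Prop :=
  exists A : dfa S, L = [set u | dfa_accepts A u].

Record cfg (S : finType) := CFG {
  cfg_nt : finType;
  cfg_start : cfg_nt;
  cfg_prods : seq (cfg_nt * seq (cfg_nt + S)) }.

Inductive cfg_step (S : finType) (G : cfg S) :
    seq (cfg_nt G + S) -> seq (cfg_nt G + S) -> Prop :=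
| CfgStep (u v : seq (cfg_nt G + S)) (X : cfg_nt G) (rhs : seq (cfg_nt G + S)) :
    (X, rhs) \in cfg_prods G ->
    @cfg_step S G (u ++ inl X :: v) (u ++ rhs ++ v).

Definition cfg_derives (S : finType) (G : cfg S) :=
  Relation_Operators.clos_refl_trans _ (@cfg_step S G).

Definition cfg_lang (S : finType) (G : cfg S) : lang S :=
  [set u | @cfg_derives S G [:: inl (cfg_start G)] (map inr u)].

Definition context_free (S : finType) (L : lang S) : Prop :=
  exists G : cfg S, L = cfg_lang G.

Definition factor (S : finType) (w : nat -> S) (a b : nat) : seq S :=
  mkseq (fun k => w (a + k)) (b - a).

(* V^omega : infinite concatenations v_0 v_1 v_2 ... of nonempty words of V.
   The words v_i are w(b i) ... w(b (i+1) - 1), with b 0 = 0 and b strictly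
   increasing (so that every v_i is nonempty). *)
Definition omega_power (S : finType) (V : lang S) : olang S :=
  [set w | exists b : nat -> nat,
      b 0 = 0%N /\ (forall i, (b i < b i.+1)%N) /\
      (forall i, V (factor w (b i) (b i.+1)))].

Definition omega_prod (S : finType) (U V : lang S) : olang S :=
  [set w | exists u : seq S, U u /\
      (forall k, (k < size u)%N -> w k = nth (w k) u k) /\
      omega_power V (fun k => w (size u + k)%N)].

Definition omega_class (P : forall S : finType, lang S -> Prop)
    (S : finType) (L : olang S) : Prop :=
  exists (n : nat) (U V : 'I_n -> lang S),
    (forall i, P S (U i) /\ P S (V i)) /\
    L = [set w | exists i, omega_prod (U i) (V i) w].

Definition omega_RL (S : finType) (L : olang S) := omega_class regular L.
Definition omega_CFL (S : finType) (L : olang S) := omega_class context_free L.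

Definition sqmod (R : realType) (z : R[i]) : R :=
  (complex.Re z) ^+ 2 + (complex.Im z) ^+ 2.

Definition braket (R : realType) (n : nat) (psi s : 'cV[R[i]]_n) : R[i] :=
  ((psi ^t* )%sesqui *m s) 0 0.

(* H = C^dim, initial unit vector s0, unitaries U_sigma,
   F = the subspace spanned by the rows of qa_F (vectors of C^dim). *)
Record qa (R : realType) (S : finType) := QA {
  qa_dim : nat;
  qa_s0 : 'cV[R[i]]_qa_dim;
  qa_U : S -> 'M[R[i]]_qa_dim;
  qa_F : 'M[R[i]]_qa_dim;
  qa_s0_unit : braket qa_s0 qa_s0 = 1;
  qa_U_unitary : forall a, qa_U a \is unitarymx }.

Definition in_F (R : realType) (S : finType) (A : qa R S) (psi : 'cV[R[i]]_(qa_dim A)) :=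
  (psi^T <= qa_F A)%MS.

(* disturbing run s_m on w with vector psi and checkpoints c 0 < c 1 < ...
   (c i is the checkpoint n_{i+1} of the paper; the letter sigma_m is w (m-1)):
   s_0 = s0, s_{m+1} = U_{w m} psi if m is a checkpoint, U_{w m} s_m otherwise *)
Fixpoint drun (R : realType) (S : finType) (A : qa R S) (w : nat -> S)
    (psi : 'cV[R[i]]_(qa_dim A)) (c : nat -> nat) (m : nat) : 'cV[R[i]]_(qa_dim A) :=
  match m with
  | 0 => qa_s0 A
  | m'.+1 => qa_U A (w m') *m
             (if `[< exists i, c i = m' >] then psi else @drun R S A w psi c m')
  end.

Definition checkpoints (c : nat -> nat) : Prop := forall i, (c i < c i.+1)%N.

Definition fD (R : realType) (S : finType) (A : qa R S) (w : nat -> S) : R :=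
  sup [set x : R | exists psi : 'cV[R[i]]_(qa_dim A),
         braket psi psi = 1 /\ in_F psi /\
         x = sup [set y : R | exists c : nat -> nat, checkpoints c /\
                   y = inf [set sqmod (braket psi (@drun R S A w psi c (c i))) | i in setT]]].

Definition lang_gt (R : realType) (S : finType) (A : qa R S) (lambda : R) : olang S :=
  [set w | lambda < fD A w].
Definition lang_eq1 (R : realType) (S : finType) (A : qa R S) : olang S :=
  [set w | fD A w = 1].

Definition QBA_gt (R : realType) (lambda : R) (S : finType) (L : olang S) : Prop :=
  exists A : qa R S, L = lang_gt A lambda.
Definition QBA_eq1 (R : realType) (S : finType) (L : olang S) : Prop :=
  exists A : qa R S, L = lang_eq1 A.

(* Main.v *)
Require Import Defs.
From mathcomp Require Import all_boot all_order all_algebra.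
From mathcomp Require Import all_classical all_reals.
From mathcomp Require Import complex sesquilinear spectral zify ring lra.
From Stdlib Require Import Relation_Operators Operators_Properties.
Import Order.TTheory GRing.Theory Num.Theory.
Local Open Scope ring_scope.
Local Open Scope classical_set_scope.

(** Powers of a unitary matrix return arbitrarily close to the identity on any
    given vector, so that a word accepted with value [> lambda] is still accepted
    after some positive power [b^N] has been put in front of it: only the segment
    before the first checkpoint changes.  Hence neither [{c^omega}] nor
    [{a^n b^n c^omega}] is recognized with a threshold [lambda < 1].

    In an omega-regular language, two words of a sequence can be cut and
    recombined (pigeonhole on the state of the automaton reading the current block
    of the factorization), so that [a^n b^m c^omega] with [n <> m] appears as soon as
    all [a^n b^n c^omega] are present.

    For (3), let [a] and [b] act on [C^2] by [diag(1, z)] and [diag(1, z^-1)], where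
    [z = (3 + 4i) / 5] is not a root of unity, and [c] trivially, with [F] spanned by
    the initial vector.  The word [a^n b^m c^omega] passes through finitely many
    exponents of [z], and the nonzero ones give overlaps bounded away from 1, so value
    1 forces every checkpoint to have exponent 0, hence [n = m]. *)

Set Implicit Arguments.
Unset Strict Implicit.
Unset Printing Implicit Defensive.

(* [all_algebra] shadows the name. *)
Local Notation factor := Defs.factor.

(** * Cutting and recombining words of an omega-regular language *)

Lemma nat_pigeonhole (T : finType) (f : nat -> T) :
  exists m n, (m < n)%N /\ f m = f n.
Proof.
apply: contrapT => nf.
have inj : injective (fun i : 'I_#|T|.+1 => f i).
  move=> i j fij; apply/val_inj/eqP; case: ltngtP => // lt_ij; case: nf.
    by exists i, j.
  by exists j, i.
by have := leq_card _ inj; rewrite card_ord ltnn.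
Qed.

Section Factor.
Variable S : finType.
Implicit Types w : nat -> S.

Lemma size_factor w a b : size (factor w a b) = (b - a)%N.
Proof. exact: size_mkseq. Qed.

Lemma nth_factor x w a b k : (k < b - a)%N -> nth x (factor w a b) k = w (a + k)%N.
Proof. exact: nth_mkseq. Qed.

Lemma eq_factor w w' a b a' b' : (b - a = b' - a')%N ->
  (forall k, (k < b - a)%N -> w (a + k)%N = w' (a' + k)%N) ->
  factor w a b = factor w' a' b'.
Proof.
move=> eqd eqw; apply: (@eq_from_nth _ (w 0%N)); first by rewrite !size_factor.
by move=> k; rewrite size_factor => ltk; rewrite !nth_factor -?eqd ?eqw.
Qed.

Lemma factor_cat w a b c : (a <= b <= c)%N ->
  factor w a c = factor w a b ++ factor w b c.
Proof.
move=> /andP[ab bc]; apply: (@eq_from_nth _ (w 0%N)).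
  by rewrite size_cat !size_factor; lia.
move=> k; rewrite nth_cat !size_factor => ltk.
rewrite nth_factor //; case: ltnP => h; rewrite nth_factor //; last by lia.
by congr w; lia.
Qed.

(* The block [0] is the word of [U], the only one that may be empty. *)
Definition blocks (U V : lang S) w (B : nat -> nat) : Prop :=
  [/\ B 0%N = 0%N, forall i, (B i + (i != 0%N) <= B i.+1)%N
    & forall i, (if i == 0%N then U else V) (factor w (B i) (B i.+1))].

(** The prefix from [U] and the blocks from [V] become one sequence of cut points, so that a cut
    inside the prefix and one inside a later block are treated alike. *)
Lemma omega_prodP (U V : lang S) w :
  omega_prod U V w <-> exists B, blocks U V w B.
Proof.
split.
  case=> u [Uu [wu [b [b0 [bS Vb]]]]].
  exists (fun k => if k is k'.+1 then size u + b k' else 0)%N; split => //.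
    case=> [|i] //=.
    by have := bS i; lia.
  case=> [|i] /=; last first.
    suff -> : factor w (size u + b i) (size u + b i.+1) =
             factor (fun k => w (size u + k)%N) (b i) (b i.+1) by exact: Vb.
    by apply: eq_factor => [|k _]; [lia | rewrite addnA].
  suff -> : factor w 0 (size u + b 0%N) = u by [].
  rewrite b0 addn0; apply: (@eq_from_nth _ (w 0%N)); first by rewrite size_factor subn0.
  move=> k; rewrite size_factor subn0 => ltk; rewrite nth_factor ?subn0 //.
  by rewrite wu //; apply: set_nth_default.
case=> B [B0 BS LB].
have mono i : (B 1%N <= B i.+1)%N.
  by elim: i => // i IH; have := BS i.+1; lia.
exists (factor w 0 (B 1%N)); split; first by have := LB 0%N; rewrite B0.
split=> [k|].
  by rewrite size_factor subn0 => ltk; rewrite nth_factor ?subn0.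
exists (fun i => B i.+1 - B 1%N)%N; split; first by rewrite subnn.
split=> i.
  by have := BS i.+1; have := mono i; have := mono i.+1; lia.
have := LB i.+1; rewrite /= => h.
suff <- : factor w (B i.+1) (B i.+2) =
  factor (fun k => w (size (factor w 0 (B 1%N)) + k)%N)
    (B i.+1 - B 1%N) (B i.+2 - B 1%N) by [].
have := mono i; have := mono i.+1; have := BS i.+1 => h1 h2 h3.
apply: eq_factor => [|k _]; first by lia.
by rewrite size_factor; congr w; lia.
Qed.

Definition splice w w' p p' : nat -> S :=
  fun k => if (k < p)%N then w k else w' (p' + (k - p))%N.

(** Blocks after the first are nonempty, so [B] is unbounded; the least cut point beyond [p] ends
    the required block. *)
Lemma blocks_locate U V w B p : blocks U V w B ->
  exists k, (B k <= p < B k.+1)%N.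
Proof.
case=> B0 BS _.
have ub i : (i <= B i.+1)%N by elim: i => // i IH; have := BS i.+1; lia.
have ex : exists k, (p < B k)%N by exists p.+2; have := ub p.+1; lia.
case: (ex_minnP ex) => -[|k]; first by rewrite B0.
move=> pk mink; exists k; rewrite pk andbT leqNgt.
by apply/negP => /mink; rewrite ltnn.
Qed.

Lemma blocks_mono U V w B : blocks U V w B ->
  {homo B : i j / (i <= j)%N >-> (i <= j)%N}.
Proof.
case=> _ BS _ i j /subnK <-; elim: (j - i)%N => // n IH.
by rewrite addSn; have := BS (n + i)%N; lia.
Qed.

(* [t] records the component of the omega-regular expression, whether the block
   containing position [p] is the first one, and the state reached in that block. *)
Definition cut_state n (A : 'I_n * bool -> dfa S) w p
    (t : {x : 'I_n * bool & dfa_state (A x)}) : Prop :=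
  exists B k,
    [/\ blocks [set u | dfa_accepts (A ((tag t).1, true)) u]
               [set u | dfa_accepts (A ((tag t).1, false)) u] w B,
        (B k <= p < B k.+1)%N, (tag t).2 = (k == 0%N)
      & foldl (@dfa_trans S (A (tag t))) (dfa_init (A (tag t)))
          (factor w (B k) p) = tagged t].

(** Equal states at the cut make the common automaton accept the block begun in [w] and finished in
    [w']; equal flags ensure that this block is a prefix block in both words or in neither. *)
Lemma cut_state_splice n (A : 'I_n * bool -> dfa S) w w' p p' t :
  cut_state (A := A) w p t -> cut_state w' p' t ->
  omega_prod [set u | dfa_accepts (A ((tag t).1, true)) u]
             [set u | dfa_accepts (A ((tag t).1, false)) u] (splice w w' p p').
Proof.
case: t => -[i b] q [B [k [blkB /andP[kp pk] /= kb defq]]].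
case=> [B' [j [blkB' /andP[jp pj] /= kj defq']]].
have monoB := blocks_mono blkB; have monoB' := blocks_mono blkB'.
case: (blkB) (blkB') => B0 BS LB [B'0 B'S LB'].
apply/omega_prodP.
(* Cut points of [w] up to the start of block [k], then those of [w'] from the end of block [j] on,
   moved by [p - p']. *)
exists (fun t => if (t <= k)%N then B t else B' (t - k + j) - p' + p)%N.
have le_p' t : (k < t -> B' j.+1 <= B' (t - k + j))%N by move=> kt; apply: monoB'; lia.
split => //= t.
  case: (ltngtP t k) => [tk|tk|->].
  - exact: BS.
  - have -> : (t.+1 - k + j = (t - k + j).+1)%N by lia.
    have := B'S (t - k + j)%N; have := le_p' _ tk.
    by lia.
  - have -> : (k.+1 - k + j = j.+1)%N by lia.
    by case: (k != 0%N) => /=; lia.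
case: (ltngtP t k) => [tk|tk|->].
- suff -> : factor (splice w w' p p') (B t) (B t.+1) = factor w (B t) (B t.+1) by exact: LB.
  have := monoB _ _ tk => le1.
  apply: eq_factor => // m ltm; rewrite /splice ifT //; lia.
- have := LB' (t - k + j)%N; rewrite !ifF; [|lia..].
  have -> : (t.+1 - k + j = (t - k + j).+1)%N by lia.
  have := B'S (t - k + j)%N; have := le_p' _ tk => le1 le2.
  set u := factor w' _ _; set v := factor _ _ _; suff -> : u = v by [].
  apply: eq_factor => [|m ltm]; first by lia.
  rewrite /splice ifF; last by lia.
  by congr w'; lia.
have -> : (k.+1 - k + j = j.+1)%N by lia.
have split_factor : factor (splice w w' p p') (B k) (B' j.+1 - p' + p) =
    factor w (B k) p ++ factor w' p' (B' j.+1).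
  rewrite (@factor_cat _ _ p); last by lia.
  congr (_ ++ _); apply: eq_factor => [|m ltm]; try lia.
    by rewrite /splice ifT //; lia.
  by rewrite /splice ifF; [congr w'|]; lia.
have accB : dfa_accepts (A (i, b)) (factor w' (B' j) (B' j.+1)).
  by have := LB' j; rewrite /= kj; case: (j == 0%N).
suff : dfa_accepts (A (i, b)) (factor (splice w w' p p') (B k) (B' j.+1 - p' + p)).
  by rewrite /= kb; case: (k == 0%N).
move: accB; rewrite /dfa_accepts split_factor (@factor_cat _ _ p'); last by lia.
by rewrite !foldl_cat defq defq'.
Qed.

Lemma omega_RL_splice (L : olang S) (w : nat -> nat -> S) (p : nat -> nat) :
  omega_RL L -> (forall n, L (w n)) ->
  exists m n, (m < n)%N /\ L (splice (w n) (w m) (p n) (p m)).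
Proof.
move=> [n [U [V [reg defL]]]] Lw.
have /choice[A defA] : forall x : 'I_n * bool, exists A : dfa S,
    (if x.2 then U x.1 else V x.1) = [set u | dfa_accepts A u].
  by case=> i b; case: (reg i) => ? ?; case: b.
have prodE i : omega_prod (U i) (V i) =
    omega_prod [set u | dfa_accepts (A (i, true)) u]
               [set u | dfa_accepts (A (i, false)) u].
  by rewrite -(defA (i, true)) -(defA (i, false)).
have /choice[f cutf] : forall m, exists t, cut_state (A := A) (w m) (p m) t.
  move=> m; have := Lw m; rewrite defL => -[j]; rewrite prodE.
  move=> /omega_prodP[B blkB]; case: (blocks_locate (p m) blkB) => k kp.
  pose x := (j, k == 0%N); pose q := foldl (@dfa_trans S (A x)) (dfa_init (A x))
    (factor (w m) (B k) (p m)).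
  by exists (Tagged (fun x => dfa_state (A x)) q), B, k.
have [m [m' [ltm fm]]] := nat_pigeonhole f.
exists m, m'; split=> //; rewrite defL; exists (tag (f m)).1; rewrite prodE.
by apply: cut_state_splice => //; rewrite fm.
Qed.

End Factor.

(** * The words a^n b^m c^omega and the languages built from them *)

Local Notation letter := (option bool).
Local Notation la := (Some true).
Local Notation lb := (Some false).
Local Notation lc := (@None bool).

Definition abc_word n m : nat -> letter :=
  fun k => if (k < n)%N then la else if (k < n + m)%N then lb else lc.

Lemma abc_word_inj n m n' m' :
  abc_word n m = abc_word n' m' -> n = n' /\ m = m'.
Proof.
move=> eqw; have E k := congr1 (fun f => f k) eqw.
have nn' : n = n'.
  apply/eqP; case: ltngtP => // ltn.
    by have := E n; rewrite /abc_word ltn ltnn; case: ifP.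
  by have := E n'; rewrite /abc_word ltn ltnn; case: ifP.
split=> //; move: E; rewrite {}nn' => E.
apply/eqP; case: ltngtP => // ltm.
  by have := E (n' + m)%N; rewrite /abc_word ltnn ltn_add2l ltm ltnNge leq_addr.
by have := E (n' + m')%N; rewrite /abc_word ltnn ltn_add2l ltm ltnNge leq_addr.
Qed.

Lemma splice_abc_word n m :
  splice (abc_word n n) (abc_word m m) n m = abc_word n m.
Proof.
apply: funext => k; rewrite /splice /abc_word; case: (ltnP k n) => // nk.
by do ![case: ifP => ?] => //; lia.
Qed.

(** Each [abc_word n n] is cut at the end of its a-block, so that a recombined word has unequal
    blocks. The form with a general [L] serves both (2) and (3). *)
Lemma not_omega_RL_abc (L : olang letter) :
  (forall n, L (abc_word n n)) -> (forall n m, L (abc_word n m) -> n = m) ->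
  ~ omega_RL L.
Proof.
move=> Lnn Lnm regL.
have [m [n [ltmn]]] := omega_RL_splice id regL Lnn.
by rewrite splice_abc_word => /Lnm nm; rewrite nm ltnn in ltmn.
Qed.

Lemma omega_RL_c : omega_RL [set abc_word 0 0].
Proof.
(* The state records whether only [lc] has been read; the accepted language provides both the prefix
   and the blocks. *)
pose A := @DFA letter bool true (fun q x => q && (x == lc)) [set true]%SET.
have accE u : dfa_accepts A u <-> all (pred1 lc) u.
  rewrite /dfa_accepts /= inE.
  suff -> b : foldl (fun q x => q && (x == lc)) b u = b && all (pred1 lc) u.
    by rewrite andTb eqb_id.
  by elim: u b => [|x u IH] b /=; rewrite ?andbT // IH andbA.
pose V := [set u | dfa_accepts A u].
exists 1%N, (fun=> V), (fun=> V); split; first by move=> _; split; exists A.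
apply/seteqP; split => [_ ->|w] /=.
  exists ord0, [::]; split; first exact/accE.
  split=> //; exists id; do 2!split=> //; move=> i; apply/accE/allP => x.
  by case/mapP => k _ ->.
case=> _ [u [/accE/allP uc [wu [b [b0 [bS Vb]]]]]].
apply: funext => k; rewrite /abc_word /=.
case: (ltnP k (size u)) => ku.
  by rewrite wu //; apply/eqP/uc/mem_nth.
have [B blkB] : exists B, blocks [set u] V w B.
  by apply/omega_prodP; exists u; split=> //; split=> //; exists b.
have [[|i] /andP[ik ki]] := blocks_locate k blkB; case: (blkB) => B0 BS LB.
  have eu : factor w 0 (B 1%N) = u by have := LB 0%N; rewrite B0.
  by move: ku; rewrite -eu size_factor; lia.
have /accE/allP/(_ (w k)) := LB i.+1; rewrite inE => h; apply/eqP/h.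
apply/(nthP lc); exists (k - B i.+1)%N; rewrite ?size_factor ?nth_factor; try lia.
by congr w; lia.
Qed.

Definition anbn_cfg : cfg letter :=
  @CFG letter unit tt [:: (tt, [::]); (tt, [:: inr la; inl tt; inr lb])].
Definition c_cfg : cfg letter := @CFG letter unit tt [:: (tt, [:: inr lc])].

Definition ab_word n : seq letter := nseq n la ++ nseq n lb.

(** As [x] occurs only once on the right, its two displayed occurrences coincide; this locates the
    single nonterminal of a sentential form. *)
Lemma cat_cons_nseq (T : eqType) (x y z : T) (u v : seq T) i j :
  x != y -> x != z -> u ++ x :: v = nseq i y ++ x :: nseq j z ->
  u = nseq i y /\ v = nseq j z.
Proof.
move=> xy xz; elim: i u => [|i IH] [|t u] //=.
- by case.
- case=> _ E; have : x \in nseq j z by rewrite -E mem_cat mem_head orbT.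
  by rewrite mem_nseq (negbTE xz) andbF.
- by case=> E; rewrite E eqxx in xy.
- by case=> -> /IH[-> ->].
Qed.

Lemma nseq_cat_cons (T : Type) n (x : T) s : nseq n x ++ x :: s = nseq n.+1 x ++ s.
Proof. by elim: n => //= n ->. Qed.

Lemma cfg_lang_anbn : cfg_lang anbn_cfg = range ab_word.
Proof.
apply/seteqP; split => [u|_ [n _ <-]]; rewrite /cfg_lang /cfg_derives /=.
  have map_ab n (u' : seq letter) :
      map inr u' = nseq n (inr la) ++ nseq n (inr lb) :> seq (unit + letter) ->
      u' = ab_word n.
    have -> : nseq n (inr la) ++ nseq n (inr lb) =
        map inr (ab_word n) :> seq (unit + letter) by rewrite map_cat !map_nseq.
    by apply: inj_map => ? ? [].
  (* Invariant of derivations: equally many [la] and [lb], with at most one nonterminal, which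
     stands between them. *)
  suff inv s : clos_refl_trans _ (cfg_step (G := anbn_cfg)) [:: inl tt] s ->
      exists n, s = nseq n (inr la) ++ inl tt :: nseq n (inr lb) \/
                s = nseq n (inr la) ++ nseq n (inr lb).
    move=> /inv[n [E|E]]; last by exists n => //; apply/esym/map_ab.
    have : inl tt \in (map inr u : seq (unit + letter)).
      by rewrite E mem_cat mem_head orbT.
    by case/mapP.
  move=> /clos_rt_rtn1_iff; elim=> [|s1 s2 st _ [n IH]].
    by exists 0%N; left.
  case: st IH => x y [] rhs; rewrite !inE => prod [E|E]; last first.
    have : inl tt \in x ++ inl tt :: y by rewrite mem_cat mem_head orbT.
    by rewrite E mem_cat !mem_nseq /= !andbF.
  have [-> ->] := cat_cons_nseq (isT : inl tt != inr la) (isT : inl tt != inr lb) E.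
  case/orP: prod => /eqP[->]; first by exists n; right.
  by exists n.+1; left; rewrite -(nseq_cat_cons n (inr la)).
have der k : clos_refl_trans _ (cfg_step (G := anbn_cfg)) [:: inl tt]
    (nseq k (inr la) ++ inl tt :: nseq k (inr lb)).
  elim: k => [|k IH]; first exact: rt_refl.
  apply: rt_trans IH _; apply: rt_step.
  rewrite -(nseq_cat_cons k (inr la)).
  exact: (CfgStep (G := anbn_cfg) _ _ (X := tt) (rhs := [:: inr la; inl tt; inr lb])).
apply: rt_trans (der n) _; apply: rt_step.
rewrite map_cat !map_nseq.
exact: (CfgStep (G := anbn_cfg) _ _ (X := tt) (rhs := [::])).
Qed.

Lemma cfg_lang_c : cfg_lang c_cfg = [set [:: lc]].
Proof.
apply/seteqP; split => [u|_ ->]; rewrite /cfg_lang /cfg_derives /=.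
  suff inv s : clos_refl_trans _ (cfg_step (G := c_cfg)) [:: inl tt] s ->
      s = [:: inl tt] \/ s = [:: inr lc].
    by move=> /inv[]; case: u => [|x [|]] //= [->].
  move=> /clos_rt_rtn1_iff; elim=> [|s1 s2 st _ IH]; first by left.
  case: st IH => x y [] rhs; rewrite !inE => /eqP[->] [|] /=;
    case: x => [|t [|t' x]] //= -[] //.
  by move=> ->; right.
apply: rt_step.
exact: (CfgStep (G := c_cfg) [::] [::] (X := tt) (rhs := [:: inr lc])).
Qed.

Definition abc_lang : olang letter := range (fun n => abc_word n n).

Lemma omega_CFL_abc_lang : omega_CFL abc_lang.
Proof.
exists 1%N, (fun=> cfg_lang anbn_cfg), (fun=> cfg_lang c_cfg).
split; first by move=> _; split; [exists anbn_cfg | exists c_cfg].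
rewrite cfg_lang_anbn cfg_lang_c; apply/seteqP; split => [_ [n _ <-]|w] /=.
  exists ord0, (ab_word n); split; first by exists n.
  rewrite size_cat !size_nseq; split=> [k ltk|].
    rewrite nth_cat size_nseq !nth_nseq /abc_word ltk.
    by case: ltnP => // ?; rewrite ifT //; lia.
  exists id; do 2!split=> //; move=> i; rewrite /factor subSnn /=.
  by rewrite /abc_word /mkseq /= ifF ?ifF //; lia.
case=> _ [_ [[n _ <-] [wu [b [b0 [bS Vb]]]]]]; exists n => //.
(* Every block is the one-letter word [lc], which forces the cut points. *)
have bi i : b i = i.
  elim: i => // i IH; have := congr1 size (Vb i).
  by rewrite size_factor /= IH; have := bS i; lia.
rewrite size_cat !size_nseq in wu Vb.
apply: funext => k; rewrite /abc_word; case: (ltnP k (n + n)) => kn.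
  by rewrite wu // nth_cat size_nseq !nth_nseq; do ![case: ifP => //]; lia.
rewrite ifF; last by lia.
have /(congr1 (fun s => nth lc s 0)) := Vb (k - (n + n))%N.
rewrite nth_factor !bi; last by lia.
by rewrite addn0 subnKC.
Qed.

Lemma abc_langE n m : abc_lang (abc_word n m) <-> n = m.
Proof.
split=> [[k _ /abc_word_inj[<- <-]] //|->].
by exists m.
Qed.

(** * Overlaps of vectors and recurrence of unitary powers *)

Section Braket.
Variable R : realType.
Implicit Types z : R[i].

Lemma sqmodE z : (sqmod z)%:C%C = `|z| ^+ 2.
Proof. exact: add_Re2_Im2. Qed.

Lemma sqmod_ge0 z : 0 <= sqmod z.
Proof. by rewrite addr_ge0 ?sqr_ge0. Qed.

Lemma sqmodM z z' : sqmod (z * z') = sqmod z * sqmod z'.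
Proof. by case: z z' => [a b] [c d]; rewrite /sqmod /=; ring. Qed.

Lemma sqmodB z z' : sqmod (z - z') =
  (complex.Re z - complex.Re z') ^+ 2 + (complex.Im z - complex.Im z') ^+ 2.
Proof. by case: z z' => [a b] [c d]. Qed.

(** Triangle inequality for the modulus; since [sqmod] measures squared distances, the radius is the
    square of the gap between the moduli. *)
Lemma sqmod_near (mu : R) z : 0 <= mu -> mu < sqmod z ->
  exists2 e : R, 0 < e & forall z', sqmod (z' - z) < e -> mu < sqmod z'.
Proof.
move=> mu0 muz.
have lt_sqrt : Num.sqrt mu < Num.sqrt (sqmod z).
  by rewrite ltr_sqrt // (le_lt_trans mu0).
exists ((Num.sqrt (sqmod z) - Num.sqrt mu) ^+ 2).
  by rewrite exprn_gt0 // subr_gt0.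
have normcE (y : R[i]) : Num.sqrt (sqmod y) = Normc.normc y by case: y.
move=> z' near; rewrite ltNge; apply/negP => /ler_wsqrtr.
have : Num.sqrt (sqmod (z' - z)) < Num.sqrt (sqmod z) - Num.sqrt mu.
  rewrite -[ltRHS]ger0_norm ?subr_ge0 1?ltW // -sqrtr_sqr ltr_sqrt //.
  by rewrite exprn_gt0 // subr_gt0.
have := le_normcD (z - z') z'.
rewrite subrK -opprB normcN -!normcE; lra.
Qed.

Definition sqnorm n (v : 'cV[R[i]]_n) : R := \sum_k sqmod (v k 0).

Lemma braketE n (u v : 'cV[R[i]]_n) : braket u v = \sum_k (u k 0)^* * v k 0.
Proof. by rewrite /braket mxE; apply: eq_bigr => k _; rewrite !mxE. Qed.

Lemma braket_self n (v : 'cV[R[i]]_n) : braket v v = (sqnorm v)%:C%C.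
Proof.
rewrite braketE /sqnorm rmorph_sum; apply: eq_bigr => k _.
by rewrite -normCKC -sqmodE.
Qed.

Lemma braket_self1 n (v : 'cV[R[i]]_n) : braket v v = 1 <-> sqnorm v = 1.
Proof. by rewrite braket_self; split=> [/complexI//|->]. Qed.

Lemma braket_CauchySchwarz n (u v : 'cV[R[i]]_n) :
  sqmod (braket u v) <= sqnorm u * sqnorm v.
Proof.
have dotE (x y : 'cV[R[i]]_n) : dotmx y^T x^T = braket x y.
  by rewrite dotmxE braketE mxE; apply: eq_bigr => k _; rewrite !mxE mulrC.
have h : `|dotmx v^T u^T| ^+ 2 <= dotmx v^T v^T * dotmx u^T u^T.
  by case: (CauchySchwarz (@dotmx _ n) v^T u^T).
by rewrite !dotE !braket_self -sqmodE -rmorphM lecR mulrC in h.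
Qed.

Lemma braketBr n (u v v' : 'cV[R[i]]_n) :
  braket u (v - v') = braket u v - braket u v'.
Proof. by rewrite /braket mulmxBr !mxE. Qed.

Lemma braket_unitary n (U : 'M[R[i]]_n) (u v : 'cV[R[i]]_n) :
  U \is unitarymx -> braket (U *m u) (U *m v) = braket u v.
Proof.
move=> unitU; rewrite /braket trmx_mul map_mxM mulmxA.
by rewrite mulmxKtV.
Qed.

Lemma sqnorm_unitary n (U : 'M[R[i]]_n) (v : 'cV[R[i]]_n) :
  U \is unitarymx -> sqnorm (U *m v) = sqnorm v.
Proof. by move=> unitU; apply: complexI; rewrite -!braket_self braket_unitary. Qed.

Lemma sqmod_le_sqnorm n (v : 'cV[R[i]]_n) k : sqmod (v k 0) <= sqnorm v.
Proof.
by rewrite /sqnorm (bigD1 k) //= lerDl sumr_ge0 // => *; apply: sqmod_ge0.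
Qed.

(** Pigeonhole on a grid of mesh [1 / K < e] in the cube [[-1, 1]^I]: points of one cell differ by
    less than [e] in each coordinate. *)
Lemma bounded_recurrence (I : finType) (x : nat -> I -> R) (e : R) :
  0 < e -> (forall n i, `|x n i| <= 1) ->
  exists m n, (m < n)%N /\ forall i, `|x n i - x m i| < e.
Proof.
move=> e0 bx; pose K := (Num.truncn e^-1).+1.
have K0 : 0 < K%:R :> R by rewrite ltr0n.
have Ke : 1 < K%:R * e.
  by rewrite mulrC -ltr_pdivrMl // mulr1 truncnS_gt.
(* The shift by 1 makes the values nonnegative, so that truncation is the integer part; the value
   [2 * K] may be attained. *)
pose y n i := K%:R * (x n i + 1).
have y0 n i : 0 <= y n i.
  by rewrite mulr_ge0 ?(ltW K0) //; have := bx n i; rewrite ler_norml => /andP[]; lra.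
pose f n := [ffun i => inord (Num.truncn (y n i)) : 'I_(2 * K).+1].
have [m [n [ltmn fmn]]] := nat_pigeonhole f.
exists m, n; split=> // i.
have val_f k : nat_of_ord (f k i) = Num.truncn (y k i).
  rewrite ffunE inordK // ltnS truncn_le_nat.
  apply: (@le_lt_trans _ _ (2 * K)%:R); last by rewrite ltr_nat.
  rewrite natrM /y [_ * K%:R]mulrC ler_wpM2l ?(ltW K0) //.
  by have := bx k i; rewrite ler_norml => /andP[]; lra.
have : Num.truncn (y m i) = Num.truncn (y n i) by rewrite -!val_f fmn.
have := truncn_itv (y0 m i); have := truncn_itv (y0 n i).
set a := Num.truncn _; set b := Num.truncn _ => /andP[h1 h2] /andP[h3 h4] E.
rewrite -natr1 {}E in h2 h3 h4 *; rewrite -natr1 in h4.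
have : `|K%:R * (x n i - x m i)| < 1.
  by rewrite ltr_norml; apply/andP; move: h1 h2 h3 h4; rewrite /y; split; lra.
rewrite normrM ger0_norm ?ltW // => lt1.
by rewrite -(ltr_pM2l K0) (lt_trans lt1).
Qed.

(** Real and imaginary parts along the orbit are bounded, so two iterates [U^m s] and [U^k s] are
    close; the isometry [U^m] is then cancelled. *)
Lemma unitary_recurrence n (U : 'M[R[i]]_n) (s : 'cV[R[i]]_n) (e : R) :
  U \is unitarymx -> sqnorm s = 1 -> 0 < e ->
  exists2 N, (0 < N)%N & sqnorm (iter N (mulmx U) s - s) < e.
Proof.
move=> unitU s1 e0.
have iter_norm k v : sqnorm (iter k (mulmx U) v) = sqnorm v.
  by elim: k => //= k IH; rewrite sqnorm_unitary.
have iterB k u v : iter k (mulmx U) (u - v) = iter k (mulmx U) u - iter k (mulmx U) v.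
  by elim: k => //= k ->; rewrite mulmxBr.
pose x k (j : 'I_n * bool) :=
  let z := iter k (mulmx U) s j.1 0 in if j.2 then complex.Re z else complex.Im z.
have bx k j : `|x k j| <= 1.
  have le1 : sqmod (iter k (mulmx U) s j.1 0) <= 1.
    by rewrite -s1 -(iter_norm k s) sqmod_le_sqnorm.
  rewrite -(@expr_le1 _ 2) // real_normK ?num_real //.
  move: le1; rewrite /x /sqmod.
  set a := complex.Re _; set b := complex.Im _.
  have := sqr_ge0 a; have := sqr_ge0 b.
  by case: j.2; lra.
(* The bound 1 gives [t ^+ 2 <= d] when [|t| < d]; the factor [n.+1] makes a sum of [n] terms
   [2 * d] strictly less than [e]. *)
pose d := Num.min 1 (e / (2 * n.+1%:R)).
have d0 : 0 < d by rewrite lt_min ltr01 divr_gt0 // mulr_gt0 ?ltr0n.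
have [m [k [ltmk near]]] := bounded_recurrence d0 bx.
exists (k - m)%N; first by rewrite subn_gt0.
rewrite -(iter_norm m) iterB -iterD subnKC ?(ltnW ltmk) //.
set v := _ - _.
have vk j : sqmod (v j 0) <= 2 * d.
  have h1 := near (j, true); have h2 := near (j, false).
  have -> : sqmod (v j 0) =
      (x k (j, true) - x m (j, true)) ^+ 2 + (x k (j, false) - x m (j, false)) ^+ 2.
    by rewrite /v !mxE sqmodB.
  have sq_le (t : R) : `|t| < d -> t ^+ 2 <= d.
    move=> td; have d1 : d <= 1 by rewrite ge_min lexx.
    rewrite -real_normK ?num_real // expr2.
    by rewrite (le_trans _ (ltW td)) // ler_piMr // (le_trans (ltW td)).
  by have := sq_le _ h1; have := sq_le _ h2; lra.
apply: (@le_lt_trans _ _ (\sum_(j < n) 2 * d)); first exact: ler_sum.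
rewrite sumr_const card_ord -[_ *+ n]mulr_natr.
have de : d <= e / (2 * n.+1%:R) by rewrite ge_min lexx orbT.
apply: (@lt_le_trans _ _ (2 * d * n.+1%:R)).
  by rewrite ltr_pM2l ?ltr_nat // mulr_gt0.
move: de; rewrite ler_pdivlMr; first by lra.
by rewrite mulr_gt0 ?ltr0n.
Qed.

End Braket.

(** * Disturbing runs and pumping *)

Lemma checkpoints_mono c : checkpoints c ->
  {homo c : i j / (i < j)%N >-> (i < j)%N}.
Proof. by move=> cc; apply: homo_ltn cc => ? ? ?; apply: ltn_trans. Qed.

Lemma checkpoints_id : checkpoints id.
Proof. by move=> k; apply: ltnSn. Qed.

Section Runs.
Variables (R : realType) (S : finType) (A : qa R S).
Implicit Types (w : nat -> S) (psi v : 'cV[R[i]]_(qa_dim A)) (c : nat -> nat).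

Local Notation drun := (@drun R S A).

(** Undisturbed evolution from position [p]; the disturbing run has this form between consecutive
    checkpoints. *)
Fixpoint evolve w p v l : 'cV[R[i]]_(qa_dim A) :=
  if l is l'.+1 then qa_U A (w (p + l')%N) *m evolve w p v l' else v.

Lemma evolveD w p v l l' :
  evolve w p v (l + l') = evolve w (p + l) (evolve w p v l) l'.
Proof. by elim: l' => [|l' IH]; rewrite ?addn0 // addnS /= IH addnA. Qed.

Lemma evolveB w p u v l :
  evolve w p (u - v) l = evolve w p u l - evolve w p v l.
Proof. by elim: l => //= l ->; rewrite mulmxBr. Qed.

Lemma eq_evolve w w' p p' v l :
  (forall k, (k < l)%N -> w (p + k)%N = w' (p' + k)%N) ->
  evolve w p v l = evolve w' p' v l.
Proof.
elim: l => //= l IH eqw; rewrite eqw // IH // => k kl.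
by apply: eqw; rewrite ltnW.
Qed.

Lemma sqnorm_evolve w p v l : sqnorm (evolve w p v l) = sqnorm v.
Proof. by elim: l => //= l IH; rewrite sqnorm_unitary // qa_U_unitary. Qed.

Lemma drun_first w psi c : checkpoints c ->
  drun w psi c (c 0%N) = evolve w 0 (qa_s0 A) (c 0%N).
Proof.
move=> /checkpoints_mono cmono.
suff H l : (l <= c 0%N)%N -> drun w psi c l = evolve w 0 (qa_s0 A) l by exact: H.
elim: l => //= l IH lc; rewrite add0n asboolF ?IH 1?ltnW // => -[j cj].
by case: j cj => [|j] cj; [|have := cmono 0%N j.+1 isT]; lia.
Qed.

Lemma drun_next w psi c k : checkpoints c ->
  drun w psi c (c k.+1) = evolve w (c k) psi (c k.+1 - c k).
Proof.
move=> ck; have cmono := checkpoints_mono ck.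
(* The case [l = 0] is excluded: at [c k] itself the run still holds the state before its
   replacement by [psi]. *)
suff H l : (0 < l <= c k.+1 - c k)%N ->
    drun w psi c (c k + l) = evolve w (c k) psi l.
  by rewrite -H ?subnKC ?leqnn ?andbT ?subn_gt0 //; apply: ltnW.
elim: l => // -[_ _|l IH lc]; rewrite addnS /=.
  by rewrite asboolT //; exists k; rewrite addn0.
rewrite -/(drun _ _ _ (c k + l.+1)) asboolF ?IH //; first by lia.
move=> [j cj]; case: (ltngtP j k) => [jk|kj|E].
- by have := cmono _ _ jk; lia.
- have : (c k.+1 <= c j)%N.
    by move: kj; rewrite leq_eqVlt => /predU1P[->//|/cmono]; lia.
  by lia.
- by rewrite E in cj; lia.
Qed.

Lemma sqnorm_drun w psi c m : sqnorm psi = 1 -> sqnorm (drun w psi c m) = 1.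
Proof.
move=> psi1; elim: m => [|m IH] /=; first exact/braket_self1/qa_s0_unit.
by rewrite sqnorm_unitary ?qa_U_unitary //; case: ifP.
Qed.

Definition overlap w psi c k : R := sqmod (braket psi (drun w psi c (c k))).

Lemma overlap_le1 w psi c k : sqnorm psi = 1 -> overlap w psi c k <= 1.
Proof.
move=> psi1; apply: le_trans (braket_CauchySchwarz _ _) _.
by rewrite psi1 sqnorm_drun // mulr1.
Qed.

Let value w psi c : R := inf [set overlap w psi c k | k in setT].

Let value_ge w psi c x : (forall k, x <= overlap w psi c k) -> x <= value w psi c.
Proof.
move=> le_x; apply: lb_le_inf; first by exists (overlap w psi c 0%N), 0%N.
by move=> _ [k _ <-].
Qed.

Let value_le w psi c k : value w psi c <= overlap w psi c k.
Proof.
apply: ge_inf; last by exists k.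
by exists 0 => _ [j _ <-]; apply: sqmod_ge0.
Qed.

Let best w psi : R := sup [set y | exists c, checkpoints c /\ y = value w psi c].

Let value_le_best w psi c : sqnorm psi = 1 -> checkpoints c ->
  value w psi c <= best w psi.
Proof.
move=> psi1 cc; apply: ub_le_sup; last by exists c.
exists 1 => _ [c' [_ ->]].
exact: le_trans (value_le w psi c' 0%N) (overlap_le1 _ _ _ psi1).
Qed.

Let best_gt w psi lam : lam < best w psi ->
  exists2 c, checkpoints c & lam < value w psi c.
Proof.
move=> /sup_gt[|_ [c [cc ->]] ltc]; last by exists c.
by exists (value w psi id), id; split=> //; apply: checkpoints_id.
Qed.

(** Unit vectors have overlap at most 1, so both suprema are over bounded sets and dominate their
    members. *)
Lemma fD_ge w psi c x : sqnorm psi = 1 -> in_F psi -> checkpoints c ->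
  (forall k, x <= overlap w psi c k) -> x <= fD A w.
Proof.
move=> psi1 Fpsi cc /value_ge le_x; apply: le_trans le_x _.
apply: le_trans (value_le_best w psi1 cc) _.
apply: ub_le_sup; last by exists psi; split; [exact/braket_self1|].
exists 1 => _ [phi [/braket_self1 phi1 [_ ->]]].
apply: ge_sup; first by exists (value w phi id), id; split=> //; apply: checkpoints_id.
move=> _ [c' [_ ->]].
exact: le_trans (value_le w phi c' 0%N) (overlap_le1 _ _ _ phi1).
Qed.

Lemma fD_gt w lam : 0 <= lam < fD A w -> exists psi c x,
  [/\ sqnorm psi = 1, in_F psi, checkpoints c, lam < x
    & forall k, x <= overlap w psi c k].
Proof.
case/andP=> lam0 ltfD.
have /sup_gt-/(_ _ ltfD) : [set x : R | exists psi, braket psi psi = 1 /\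
    in_F psi /\ x = best w psi] !=set0.
  (* If [F] contained no unit vector, the supremum would be the default 0, which cannot exceed
     [lam >= 0]. *)
  apply/set0P/eqP => E0; move: ltfD; rewrite /fD -/(best w) E0 sup0.
  by rewrite ltNge lam0.
case=> _ [psi [/braket_self1 psi1 [Fpsi ->]]] /best_gt[c cc ltc].
by exists psi, c, (value w psi c); split=> // k; apply: value_le.
Qed.

Lemma fD_le1 w : fD A w <= 1.
Proof.
rewrite leNgt; apply/negP => lt1.
have [|psi [c [x [psi1 _ _ lt1x /(_ 0%N) le_x]]]] := @fD_gt w 1.
  by rewrite ler01.
by have := lt_le_trans lt1x (le_trans le_x (overlap_le1 _ _ _ psi1)); rewrite ltxx.
Qed.

Definition prepend (x : S) N w : nat -> S := fun k => if (k < N)%N then x else w (k - N)%N.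

Lemma fD_pump w x lam : 0 <= lam < fD A w ->
  exists2 N, (0 < N)%N & lam < fD A (prepend x N w).
Proof.
move=> lamfD; have [psi [c [y [psi1 Fpsi cc lty ley]]]] := fD_gt lamfD.
(* A strict bound on all overlaps may be lost in the infimum; [mu] keeps a margin above [lam]. *)
pose mu := (lam + y) / 2.
have [lam_mu mu_y] : lam < mu /\ mu < y by rewrite /mu; lra.
have mu0 : 0 <= mu by case/andP: lamfD => lam0 _; apply/ltW/(le_lt_trans lam0).
have := ley 0%N; rewrite /overlap drun_first // => /(lt_le_trans mu_y).
case/(sqmod_near mu0) => e e0 near.
have s1 : sqnorm (qa_s0 A) = 1 by exact/braket_self1/qa_s0_unit.
have [N N0 nearN] := unitary_recurrence (qa_U_unitary A x) s1 e0.
exists N => //; apply: lt_le_trans lam_mu _.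
(* The checkpoints move with the word, so only the segment before the first one reads the new
   letters. *)
have cc' : checkpoints (fun k => N + c k)%N by move=> k; rewrite ltn_add2l.
have evolve_shift p v l : evolve (prepend x N w) (N + p) v l = evolve w p v l.
  apply: eq_evolve => k _; rewrite /prepend ifF; last by lia.
  by congr w; lia.
apply: (fD_ge psi1 Fpsi cc') => -[|k]; rewrite /overlap.
  rewrite drun_first // evolveD add0n -[X in evolve _ X _ (c 0%N)]addn0 evolve_shift.
  have -> : evolve (prepend x N w) 0 (qa_s0 A) N = iter N (mulmx (qa_U A x)) (qa_s0 A).
    have H l : (l <= N)%N -> evolve (prepend x N w) 0 (qa_s0 A) l =
        iter l (mulmx (qa_U A x)) (qa_s0 A).
      by elim: l => //= l IH lN; rewrite IH 1?ltnW // /prepend add0n lN.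
    exact: H.
  apply/ltW/near; rewrite -braketBr -evolveB.
  apply: le_lt_trans (braket_CauchySchwarz _ _) _.
  by rewrite psi1 mul1r sqnorm_evolve.
rewrite drun_next // subnDl evolve_shift -drun_next //.
exact: le_trans (ltW mu_y) (ley k.+1).
Qed.

End Runs.

(** Pumping [lb] in front of c^omega produces some [abc_word 0 N] with [N > 0]. *)
Lemma not_QBA_gt_abc (R : realType) (lam : R) (L : olang letter) :
  0 <= lam -> L (abc_word 0 0) -> (forall N, L (abc_word 0 N) -> N = 0%N) ->
  ~ QBA_gt lam L.
Proof.
move=> lam0 L0 LN [A defL].
have ltfD : 0 <= lam < fD A (abc_word 0 0) by rewrite lam0; move: L0; rewrite defL.
have [N N0] := fD_pump lb ltfD.
have -> : prepend lb N (abc_word 0 0) = abc_word 0 N.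
  by apply: funext => k; rewrite /prepend /abc_word.
move=> accN; have : L (abc_word 0 N) by rewrite defL.
by move/LN => E; rewrite E in N0.
Qed.

(** * An automaton comparing the numbers of a and b by a phase *)

Section PhaseAutomaton.
Variable R : realType.

Lemma sqmod1 : sqmod (1 : R[i]) = 1.
Proof. by rewrite /sqmod /= expr1n expr0n addr0. Qed.

Definition phase : R[i] := Complex (3 / 5) (4 / 5).

Lemma sqmod_phase : sqmod phase = 1.
Proof. by rewrite /sqmod /=; lra. Qed.

Lemma phase_neq0 : phase != 0.
Proof. by rewrite eq_complex /= negb_and; apply/orP; left; apply/eqP; lra. Qed.

(* [(3 + 4i)^2 = 3 + 4i] modulo 5, hence no positive power of [3 + 4i] is real. *)
Lemma gauss_expr_mod5 n : exists a b : int,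
  Complex 3 4 ^+ n.+1 = Complex (5 * a + 3)%:~R (5 * b + 4)%:~R :> R[i].
Proof.
elim: n => [|n [a [b IH]]].
  by exists 0, 0; apply/eqP; rewrite eq_complex /=; apply/andP; split; apply/eqP; ring.
exists (3 * a - 4 * b - 2), (4 * a + 3 * b + 4).
rewrite exprS IH; apply/eqP; rewrite eq_complex /=.
by apply/andP; split; apply/eqP; ring.
Qed.

(** Otherwise [(3 + 4i)^n = 5^n] would be real, while its imaginary part is 4 modulo 5. *)
Lemma phase_expr_neq1 n : (0 < n)%N -> phase ^+ n <> 1.
Proof.
case: n => // n _ phase1; have [a [b]] := gauss_expr_mod5 n.
have -> : Complex 3 4 = (5 : R)%:C%C * phase.
  by apply/eqP; rewrite eq_complex /=; apply/andP; split; apply/eqP; lra.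
rewrite exprMn phase1 mulr1 -rmorphXn => -[_ /esym/eqP].
by rewrite intr_eq0 => /eqP; lia.
Qed.

Lemma phase_exprz_neq1 (k : int) : k != 0 -> phase ^ k <> 1.
Proof.
case: k => n k0; first by apply: phase_expr_neq1; case: n k0.
by rewrite NegzE -exprnN => /(congr1 GRing.inv); rewrite invrK invr1; apply: phase_expr_neq1.
Qed.

Lemma sqmod_phase_exprz (k : int) : sqmod (phase ^ k) = 1.
Proof.
have sqmodX n : sqmod (phase ^+ n) = 1.
  by elim: n => [|n IH]; rewrite ?sqmod1 // exprS sqmodM IH sqmod_phase mulr1.
case: k => n; first exact: sqmodX.
rewrite NegzE -exprnN -[LHS]mul1r -(sqmodX n.+1) -sqmodM mulfV ?sqmod1 //.
by rewrite expf_neq0 ?phase_neq0.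
Qed.

Definition height (x : letter) : int :=
  match x with Some true => 1 | Some false => -1 | None => 0 end.

(** Both amplitudes are nonzero, so that a relative phase shows in the overlap with this vector. *)
Definition phase_s0 : 'cV[R[i]]_2 :=
  \col_(j < 2) (if j == 0 then 3 / 5 else 4 / 5 : R)%:C%C.

Definition phase_U (x : letter) : 'M[R[i]]_2 :=
  diag_mx (\row_(j < 2) if j == 0 then 1 else phase ^ height x).

Lemma sqnorm_phase_s0 : sqnorm phase_s0 = 1.
Proof. by rewrite /sqnorm big_ord_recl big_ord1 !mxE /sqmod /=; lra. Qed.

Lemma phase_s0_unit : braket phase_s0 phase_s0 = 1.
Proof. exact/braket_self1/sqnorm_phase_s0. Qed.

Lemma phase_U_unitary x : phase_U x \is unitarymx.
Proof.
apply/unitarymxP; rewrite tr_diag_mx map_diag_mx mulmx_diag -diag_const_mx.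
congr diag_mx; apply/rowP => j; rewrite !mxE -normCK -sqmodE.
by case: (j == 0); rewrite ?sqmod1 ?sqmod_phase_exprz.
Qed.

Definition phase_qa : qa R letter :=
  @QA R letter 2 phase_s0 phase_U <<phase_s0^T>>%MS phase_s0_unit phase_U_unitary.

Definition total_height (w : nat -> letter) p : int := \sum_(k < p) height (w k).

(** Squared overlap of [phase_s0] with its image under [diag(1, phase ^ k)]; the weights are the
    squared amplitudes. *)
Definition phase_overlap (k : int) : R :=
  sqmod ((9 / 25 : R)%:C%C + (16 / 25 : R)%:C%C * phase ^ k).

Lemma phase_overlap0 : phase_overlap 0 = 1.
Proof. by rewrite /phase_overlap expr0z /sqmod /=; lra. Qed.

(** If [phase ^ k = x + iy], a point of the unit circle, the overlap is [(337 + 288 x) / 625], and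
    [x = 1] only when [phase ^ k = 1]. *)
Lemma phase_overlap_lt1 k : k != 0 -> phase_overlap k < 1.
Proof.
move=> /phase_exprz_neq1; have := sqmod_phase_exprz k; rewrite /phase_overlap.
case: (phase ^ k) => x y; rewrite /sqmod /= => xy ne1.
have x1 : x != 1.
  apply/eqP => x1; apply: ne1; apply/eqP; rewrite eq_complex /= x1 eqxx /=.
  by rewrite -sqrf_eq0; apply/eqP; move: xy; rewrite x1; lra.
have : x < 1 by rewrite lt_neqAle x1 /=; have := sqr_ge0 y; nra.
by nra.
Qed.

Lemma phase_evolve w p v l j : evolve (A := phase_qa) w p v l j 0 =
  (if j == 0 then 1 else phase ^ (total_height w (p + l) - total_height w p)) * v j 0.
Proof.
elim: l => [|l IH]; first by rewrite addn0 subrr expr0z if_same mul1r.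
rewrite [evolve _ _ _ _]/= /phase_U mul_diag_mx mxE IH mxE.
case: ifP => _; first by rewrite !mul1r.
rewrite mulrA -expfzDr ?phase_neq0 //; congr (_ ^ _ * _).
by rewrite /total_height addnS big_ord_recr /=; ring.
Qed.

(** Products of the diagonal unitaries depend only on the net exponent; the factors [a] and [b]
    cover [phase_s0] itself and every vector of [F]. *)
Lemma overlap_evolve (a b : R[i]) w p l :
  sqmod (braket (a *: phase_s0) (evolve (A := phase_qa) w p (b *: phase_s0) l)) =
  sqmod a * sqmod b * phase_overlap (total_height w (p + l) - total_height w p).
Proof.
have -> : sqmod a = sqmod (a^*) by case: a => x y; rewrite /sqmod /= sqrrN.
rewrite -!sqmodM braketE big_ord_recl big_ord1 !phase_evolve !mxE /=.
have conjR (x : R) : (x%:C%C)^* = x%:C%C by exact: conjc_real.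
have -> : (9 / 25 : R) = 3 / 5 * (3 / 5) by lra.
have -> : (16 / 25 : R) = 4 / 5 * (4 / 5) by lra.
rewrite !(rmorphM _ a) /= !conjR !(rmorphM (real_complex R) (_ / _)) /=.
move: (3 / 5)%:C%C (4 / 5)%:C%C (phase ^ _) => x y u.
by congr sqmod; ring.
Qed.

Lemma total_height_abc n m p :
  total_height (abc_word n m) p = (minn p n)%:Z - (minn (p - n) m)%:Z.
Proof.
elim: p => [|p IH]; first by rewrite /total_height big_ord0 sub0n !min0n.
rewrite /total_height big_ord_recr /= -/(total_height _ p) IH /abc_word.
by do ![case: ifP => ?] => /=; lia.
Qed.

Lemma phase_qa_accepts n : fD phase_qa (abc_word n n) = 1.
Proof.
apply/eqP; rewrite eq_le fD_le1 /=.
(* All checkpoints come after both blocks, where the net exponent is 0. *)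
pose c k := (n + n + k)%N.
have cc : checkpoints c by move=> k; rewrite ltn_add2l.
have h0 k : total_height (abc_word n n) (n + n + k) = 0.
  by rewrite total_height_abc; lia.
have s1 : qa_s0 phase_qa = 1 *: phase_s0 by rewrite scale1r.
apply: (@fD_ge _ _ phase_qa _ phase_s0 c) => //.
- exact: sqnorm_phase_s0.
- by rewrite /in_F /= genmxE.
move=> [|k]; rewrite /overlap ?drun_first ?drun_next //.
  rewrite s1 -{1}[phase_s0]scale1r overlap_evolve sqmod1 add0n h0.
  by rewrite /total_height big_ord0 phase_overlap0 !mul1r.
rewrite -[phase_s0]scale1r overlap_evolve sqmod1 subnKC ?(ltnW (cc k)) // !h0.
by rewrite phase_overlap0 !mul1r.
Qed.

Lemma phase_qa_rejects n m : n <> m -> fD phase_qa (abc_word n m) < 1.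
Proof.
move=> nm; set w := abc_word n m; pose h := total_height w.
(* The height is constant from position [n + m] on, so a finite maximum bounds the overlap at every
   nonzero height. *)
pose d := \big[Num.max/0]_(p < (n + m).+1 | h p != 0) phase_overlap (h p).
have d1 : d < 1.
  by apply: bigmax_lt => // p; apply: phase_overlap_lt1.
have d0 : 0 <= d by apply: bigmax_ge_id.
have le_d p : h p != 0 -> phase_overlap (h p) <= d.
  move=> hp; have -> : h p = h (minn p (n + m)).
    by rewrite /h !total_height_abc; lia.
  have lt_p : (minn p (n + m) < (n + m).+1)%N by lia.
  apply: (@le_bigmax_cond _ _ _ _ (Ordinal lt_p) (fun p => h p != 0)
    (fun p => phase_overlap (h p))) => /=.
  by move: hp; rewrite /h !total_height_abc; lia.
rewrite ltNge; apply/negP => /(lt_le_trans d1) d_fD.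
have [|psi [c [x [psi1 Fpsi cc dx lex]]]] := @fD_gt _ _ phase_qa w d.
  by rewrite d0.
have [a psiE] : exists a, psi = a *: phase_s0.
  move: Fpsi; rewrite /in_F /= genmxE => /sub_rVP[a E]; exists a.
  by apply: trmx_inj; rewrite E linearZ.
have a1 : sqmod a = 1.
  move: psi1; rewrite psiE /sqnorm; under eq_bigr do rewrite mxE sqmodM.
  by rewrite -mulr_sumr -/(sqnorm _) sqnorm_phase_s0 mulr1.
(* By induction the segment ending at [c k] starts at height 0; a nonzero height at its end would
   give an overlap at most [d < x]. *)
have hc k : h (c k) = 0.
  elim: k => [|k IH]; apply/eqP; apply: contraT => /le_d.
    have := lex 0%N; rewrite /overlap drun_first // psiE.
    rewrite -[qa_s0 _]scale1r overlap_evolve a1 sqmod1 add0n !mul1r.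
    rewrite {2}/total_height big_ord0 subr0 -/(h _) => h1 h2.
    by have := lt_le_trans dx (le_trans h1 h2); rewrite ltxx.
  have := lex k.+1; rewrite /overlap drun_next // psiE.
  rewrite overlap_evolve a1 !mul1r subnKC ?(ltnW (cc k)) // -!/(h _) IH subr0.
  move=> h1 h2.
  by have := lt_le_trans dx (le_trans h1 h2); rewrite ltxx.
have ck k : (k <= c k)%N by elim: k => // k IH; apply: leq_ltn_trans IH (cc k).
(* At [c (n + m) >= n + m] both blocks have been read, so the height there is [n - m]. *)
have := hc (n + m)%N; have := ck (n + m)%N.
by rewrite /h total_height_abc; lia.
Qed.

End PhaseAutomaton.

Theorem theorem9 (R : realType) :
  (* (1) omega-RL is not contained in L^{>lambda}(QBA|D) *)
  (forall lambda : R, 0 <= lambda < 1 ->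
     exists (S : finType) (L : olang S), omega_RL L /\ ~ QBA_gt lambda L) /\
  (* (2) omega-CFL \ omega-RL is not contained in L^{>lambda}(QBA|D) *)
  (forall lambda : R, 0 <= lambda < 1 ->
     exists (S : finType) (L : olang S),
       omega_CFL L /\ ~ omega_RL L /\ ~ QBA_gt lambda L) /\
  (* (3) L^{=1}(QBA|D) is not contained in omega-RL *)
  (exists (S : finType) (L : olang S), QBA_eq1 R L /\ ~ omega_RL L).
Proof.
split=> [lambda /andP[lambda0 _]|].
  exists letter, [set abc_word 0 0]; split; first exact: omega_RL_c.
  by apply: not_QBA_gt_abc => // N /abc_word_inj[].
split=> [lambda /andP[lambda0 _]|].
  exists letter, abc_lang; split; first exact: omega_CFL_abc_lang.
  split; first by apply: not_omega_RL_abc => n; [|move=> m /abc_langE]; rewrite // abc_langE.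
  apply: not_QBA_gt_abc => //; first exact/abc_langE.
  by move=> N /abc_langE.
exists letter, (lang_eq1 (phase_qa R)); split; first by exists (phase_qa R).
apply: not_omega_RL_abc => [n|n m accnm]; first exact: phase_qa_accepts.
apply: contrapT => /(phase_qa_rejects R).
by rewrite [fD _ _]accnm ltxx.
Qed.
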